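(* Let $M_1,M_2$ be models of PA. If $M_1$ is 2-o.r. and the linear orders $(M_1,<_{M_1})$ and $(M_2,<_{M_2})$ are isomorphic, then $M_1$ and $M_2$ are almost $\{<,+\}$-isomorphic.
   Context: Models of PA are in the vocabulary $\{0,1,<,+,\times\}$ and ordinary, i.e. $\mathbb N$ is an initial segment. For $a\in M$, $M_{<a}=\{c\in M:c<_M a\}$. On $M\setminus\mathbb N$: $a\,E^2_M\,b$ iff there is $n\in\mathbb N$ with $a<_M b\times_M n$ and $b<_M a\times_M n$. $M$ is 2-o.r. if for all $a,b\in M\setminus\mathbb N$, $(M_{<a},<_M)\cong(M_{<b},<_M)$ implies $a\,E^2_M\,b$. An almost $\{<,+\}$-isomorphism from $M$ onto $N$ is an isomorphism $f$ of the linear orders $(M,<_M)$ onto $(N,<_N)$ such that for all $a,b\in M$ there is $n\in\mathbb N$ such that the distance between $f(a+_M b)$ and $f(a)+_N f(b)$ is $n$; $M,N$ are almost $\{<,+\}$-isomorphic if such an $f$ exists. *)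

(* Defs.v *)
From Corelib Require Import ssrfun.

Record structure : Type := Structure {
  carrier :> Type;
  zero : carrier;
  one : carrier;
  lt : carrier -> carrier -> Prop;
  add : carrier -> carrier -> carrier;
  mul : carrier -> carrier -> carrier
}.

Arguments zero {s}.
Arguments one {s}.
Arguments lt {s} _ _.
Arguments add {s} _ _.
Arguments mul {s} _ _.

(* First-order syntax over {0, 1, <, +, *}, with de Bruijn indices: variable 0
   is the one bound by the innermost quantifier. *)
Inductive term : Type :=
  | TVar (i : nat)
  | TZero
  | TOne
  | TAdd (s t : term)
  | TMul (s t : term).

Inductive formula : Type :=
  | FEq (s t : term)
  | FLt (s t : term)
  | FFalse
  | FAnd (p q : formula)
  | FOr (p q : formula)
  | FImp (p q : formula)
  | FAll (p : formula)
  | FEx (p : formula).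

Definition scons {M : Type} (x : M) (env : nat -> M) (i : nat) : M :=
  match i with
  | O => x
  | S j => env j
  end.

Fixpoint eval {M : structure} (env : nat -> M) (t : term) : M :=
  match t with
  | TVar i => env i
  | TZero => zero
  | TOne => one
  | TAdd s t => add (eval env s) (eval env t)
  | TMul s t => mul (eval env s) (eval env t)
  end.

Fixpoint sat {M : structure} (env : nat -> M) (p : formula) : Prop :=
  match p with
  | FEq s t => eval env s = eval env t
  | FLt s t => lt (eval env s) (eval env t)
  | FFalse => False
  | FAnd p q => sat env p /\ sat env q
  | FOr p q => sat env p \/ sat env q
  | FImp p q => sat env p -> sat env q
  | FAll p => forall x : M, sat (scons x env) p
  | FEx p => exists x : M, sat (scons x env) p
  end.

(* The axioms of the nonnegative part of a discretely ordered commutative ring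
   (PA^-), together with the first-order induction scheme; in the latter, the
   environment supplies the parameters. *)
Record models_PA (M : structure) : Prop := ModelsPA {
  PA_addA : forall x y z : M, add (add x y) z = add x (add y z);
  PA_addC : forall x y : M, add x y = add y x;
  PA_mulA : forall x y z : M, mul (mul x y) z = mul x (mul y z);
  PA_mulC : forall x y : M, mul x y = mul y x;
  PA_mulDr : forall x y z : M, mul x (add y z) = add (mul x y) (mul x z);
  PA_add0 : forall x : M, add x zero = x;
  PA_mul0 : forall x : M, mul x zero = zero;
  PA_mul1 : forall x : M, mul x one = x;
  PA_lt_trans : forall x y z : M, lt x y -> lt y z -> lt x z;
  PA_lt_irrefl : forall x : M, ~ lt x x;
  PA_lt_total : forall x y : M, lt x y \/ x = y \/ lt y x;
  PA_lt_add : forall x y z : M, lt x y -> lt (add x z) (add y z);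
  PA_lt_mul : forall x y z : M, lt zero z -> lt x y -> lt (mul x z) (mul y z);
  PA_sub : forall x y : M, lt x y -> exists z : M, add x z = y;
  PA_lt01 : lt (zero : M) one;
  PA_discrete : forall x : M, lt zero x -> x = one \/ lt one x;
  PA_nonneg : forall x : M, x = zero \/ lt zero x;
  PA_induction : forall (p : formula) (env : nat -> M),
    sat (scons zero env) p ->
    (forall x : M, sat (scons x env) p -> sat (scons (add x one) env) p) ->
    forall x : M, sat (scons x env) p
}.

(* The copy of the natural numbers inside M is the set of values of numerals. *)
Fixpoint numeral (M : structure) (n : nat) : M :=
  match n with
  | O => zero
  | S m => add (numeral M m) one
  end.

Definition standard {M : structure} (a : M) : Prop :=
  exists n : nat, a = numeral M n.

Definition order_iso {A B : Type} (RA : A -> A -> Prop) (RB : B -> B -> Prop)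
    (f : A -> B) : Prop :=
  bijective f /\ forall x y : A, RA x y <-> RB (f x) (f y).

Definition order_isomorphic {A B : Type}
    (RA : A -> A -> Prop) (RB : B -> B -> Prop) : Prop :=
  exists f : A -> B, order_iso RA RB f.

Definition below {M : structure} (a : M) : Type := {c : M | lt c a}.

Definition below_lt {M : structure} (a : M) (x y : below a) : Prop :=
  lt (proj1_sig x) (proj1_sig y).

Definition E2 {M : structure} (a b : M) : Prop :=
  exists n : nat, lt a (mul b (numeral M n)) /\ lt b (mul a (numeral M n)).

Definition two_order_rigid (M : structure) : Prop :=
  forall a b : M, ~ standard a -> ~ standard b ->
    order_isomorphic (below_lt a) (below_lt b) -> E2 a b.

Definition distance_is {M : structure} (x y : M) (n : nat) : Prop :=
  add x (numeral M n) = y \/ add y (numeral M n) = x.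

Definition almost_lt_add_iso (M N : structure) (f : M -> N) : Prop :=
  order_iso (@lt M) (@lt N) f /\
  forall a b : M, exists n : nat, distance_is (f (add a b)) (add (f a) (f b)) n.

Definition almost_lt_add_isomorphic (M N : structure) : Prop :=
  exists f : M -> N, almost_lt_add_iso M N f.

(* Main.v *)
From Stdlib Require Import ClassicalEpsilon FunctionalExtensionality
  PropExtensionality ProofIrrelevance Ring.
Require Import Defs.

(** A 2-o.r. model is standard, and the order alone determines addition on the
    standard model. Indeed, let [c] be nonstandard and let [J] be a proper
    initial segment that contains [c] and is closed under addition and under
    multiplication by [c]. Multiplication by [c] induces an automorphism of the
    order obtained from [M] by identifying elements whose distance is in [J]:
    it is onto because remainders modulo [c] lie in [J]. Translating whole
    classes lifts it to an order automorphism of [M] that maps each [a] outside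
    [J] to an element of the order of magnitude of [c * a], which is not
    [E2]-equivalent to [a].

    Such a [J] is obtained without coding exponentiation. Take [m] divisible by
    all standard positive numbers; the numbers [1 + z * m], [z] standard, are
    pairwise coprime, so any common multiple [y > 0] of them exceeds all
    standard powers of [c = 1 + m], and these powers generate [J]. *)

(** * Ordered semiring arithmetic and numerals *)

Section Arithmetic.

Variable M : structure.
Hypothesis hM : models_PA M.

Declare Scope PA_scope.
Local Notation "0" := (@zero M) : PA_scope.
Local Notation "1" := (@one M) : PA_scope.
Local Infix "+" := (@add M) : PA_scope.
Local Infix "*" := (@mul M) : PA_scope.
Local Infix "<" := (@lt M) : PA_scope.
Local Open Scope PA_scope.

Lemma PA_semiring : semi_ring_theory 0 1 (@add M) (@mul M) eq.
Proof.
split; intros.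
- now rewrite (PA_addC _ hM), (PA_add0 _ hM).
- apply (PA_addC _ hM).
- symmetry; apply (PA_addA _ hM).
- now rewrite (PA_mulC _ hM), (PA_mul1 _ hM).
- now rewrite (PA_mulC _ hM), (PA_mul0 _ hM).
- apply (PA_mulC _ hM).
- symmetry; apply (PA_mulA _ hM).
- now rewrite (PA_mulC _ hM), (PA_mulDr _ hM), (PA_mulC _ hM p n), (PA_mulC _ hM p m).
Qed.

Add Ring PA_ring : PA_semiring.

(** Taking the difference as a witness turns monotonicity of addition and multiplication into ring
    identities. *)
Definition le (x y : M) : Prop := exists z, x + z = y.
Local Infix "<=" := le : PA_scope.

Lemma le_refl x : x <= x.
Proof. exists 0; ring. Qed.

Lemma le_trans x y z : x <= y -> y <= z -> x <= z.
Proof. intros [u <-] [v <-]; exists (u + v); ring. Qed.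

Lemma le_0_l x : 0 <= x.
Proof. exists x; ring. Qed.

Lemma le_addr x y : x <= x + y.
Proof. now exists y. Qed.

Lemma le_add x y z t : x <= y -> z <= t -> x + z <= y + t.
Proof. intros [u <-] [v <-]; exists (u + v); ring. Qed.

Lemma le_mul x y z t : x <= y -> z <= t -> x * z <= y * t.
Proof. intros [u <-] [v <-]; exists (x * v + u * z + u * v); ring. Qed.

Lemma lt_le x y : x < y -> x <= y.
Proof. apply (PA_sub _ hM). Qed.

Lemma lt_succ_le x y : x < y -> x + 1 <= y.
Proof.
intros hxy; destruct (PA_sub _ hM _ _ hxy) as [z <-].
destruct (PA_nonneg _ hM z) as [->|hz].
- exfalso; apply (PA_lt_irrefl _ hM x); now rewrite (PA_add0 _ hM) in hxy.
- destruct (PA_discrete _ hM _ hz) as [->|h1]; [apply le_refl|].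
  apply le_add; [apply le_refl|now apply lt_le].
Qed.

Lemma le_lt_trans x y z : x <= y -> y < z -> x < z.
Proof.
intros [u <-] hz; destruct (PA_nonneg _ hM u) as [->|hu].
- now rewrite (PA_add0 _ hM) in hz.
- apply (PA_lt_trans _ hM _ (x + u)); [|exact hz].
  replace x with (0 + x) at 1 by ring; replace (x + u) with (u + x) by ring.
  now apply (PA_lt_add _ hM).
Qed.

Lemma lt_le_trans x y z : x < y -> y <= z -> x < z.
Proof.
intros hy [u <-]; destruct (PA_nonneg _ hM u) as [->|hu].
- now rewrite (PA_add0 _ hM).
- apply (PA_lt_trans _ hM _ y); [exact hy|].
  replace y with (0 + y) at 1 by ring; replace (y + u) with (u + y) by ring.
  now apply (PA_lt_add _ hM).
Qed.

Lemma lt_succ x : x < x + 1.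
Proof.
replace x with (0 + x) at 1 by ring; replace (x + 1) with (1 + x) by ring.
apply (PA_lt_add _ hM), (PA_lt01 _ hM).
Qed.

Lemma succ_le_lt x y : x + 1 <= y -> x < y.
Proof. apply lt_le_trans, lt_succ. Qed.

Lemma lt_ge_false x y : x < y -> y <= x -> False.
Proof. intros h h'; exact (PA_lt_irrefl _ hM _ (lt_le_trans _ _ _ h h')). Qed.

Lemma lt_or_le x y : x < y \/ y <= x.
Proof.
destruct (PA_lt_total _ hM x y) as [h|[->|h]]; [now left|right; apply le_refl|].
right; now apply lt_le.
Qed.

Lemma le_antisym x y : x <= y -> y <= x -> x = y.
Proof.
intros h h'; destruct (PA_lt_total _ hM x y) as [h1|[h1|h1]]; [|exact h1|];
  exfalso; eauto using lt_ge_false.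
Qed.

Lemma add_lt_le x y z t : x < y -> z <= t -> x + z < y + t.
Proof.
intros h h'; apply succ_le_lt.
replace (x + z + 1) with (x + 1 + z) by ring.
apply le_add; [now apply lt_succ_le|exact h'].
Qed.

Lemma add_le_cancel x y z : x + z <= y + z -> x <= y.
Proof.
intros h; destruct (lt_or_le y x) as [h'|h']; [exfalso|exact h'].
apply (lt_ge_false (y + z) (x + z)); [|exact h].
now apply (PA_lt_add _ hM).
Qed.

Lemma add_cancel x y z : x + z = y + z -> x = y.
Proof.
intros h; apply le_antisym; apply add_le_cancel with z; rewrite h; apply le_refl.
Qed.

Lemma mul_le_cancel x y z : 0 < z -> x * z <= y * z -> x <= y.
Proof.
intros hz h; destruct (lt_or_le y x) as [h'|h']; [exfalso|exact h'].
exact (lt_ge_false _ _ (PA_lt_mul _ hM _ _ _ hz h') h).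
Qed.

Lemma lt_succ_inv x y : x < y + 1 -> x < y \/ x = y.
Proof.
intros h; destruct (PA_lt_total _ hM x y) as [h1|[h1|h1]]; [now left|now right|].
exfalso; exact (lt_ge_false _ _ h (lt_succ_le _ _ h1)).
Qed.

Lemma not_lt_0 x : ~ x < 0.
Proof. intros h; exact (lt_ge_false _ _ h (le_0_l x)). Qed.

Lemma mul_pos x y : 0 < x -> 0 < y -> 0 < x * y.
Proof.
intros hx hy; replace 0 with (0 * y) by ring; now apply (PA_lt_mul _ hM).
Qed.

Lemma pos_add_r x y : 0 < x -> 0 < x + y.
Proof. intros h; apply lt_le_trans with x; [exact h|apply le_addr]. Qed.

Lemma factor_pos x y : 0 < x * y -> 0 < y.
Proof.
intros h; destruct (PA_nonneg _ hM y) as [->|h']; [|exact h'].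
rewrite (PA_mul0 _ hM) in h; destruct (PA_lt_irrefl _ hM _ h).
Qed.

Lemma one_le x : 0 < x -> 1 <= x.
Proof. intros h; replace 1 with (0 + 1) by ring; now apply lt_succ_le. Qed.

Lemma numeral_add i j : numeral M (i + j) = numeral M i + numeral M j.
Proof. induction i as [|i IH]; simpl; [|rewrite IH]; ring. Qed.

Lemma lt_numeral_standard x n : x < numeral M n -> standard x.
Proof.
induction n as [|n IH]; simpl; intros h; [now apply not_lt_0 in h|].
destruct (lt_succ_inv _ _ h) as [h'| ->]; [exact (IH h')|now exists n].
Qed.

Lemma numeral_lt_nonstandard x n : ~ standard x -> numeral M n < x.
Proof.
intros hx; destruct (PA_lt_total _ hM x (numeral M n)) as [h|[h|h]]; [| |exact h].
- destruct hx; exact (lt_numeral_standard _ _ h).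
- destruct hx; now exists n.
Qed.

(** * Division, divisibility and coprime moduli *)

Lemma euclid_div c y : 0 < c -> exists q r, y = c * q + r /\ r < c.
Proof.
intros hc.
(* Variables 0 to 3 are the remainder, the quotient, the induction variable [y] and the parameter
   [c]. *)
pose (p := FEx (FEx (FAnd
  (FEq (TVar 2) (TAdd (TMul (TVar 3) (TVar 1)) (TVar 0)))
  (FLt (TVar 0) (TVar 3))))).
apply (PA_induction _ hM p (fun _ => c)); simpl.
- exists 0, 0; split; [ring|exact hc].
- intros x [q [r [-> hr]]].
  destruct (PA_lt_total _ hM (r + 1) c) as [h|[h|h]].
  + exists q, (r + 1); split; [ring|exact h].
  + exists (q + 1), 0; split; [rewrite <- h; ring|exact hc].
  + destruct (lt_ge_false _ _ h (lt_succ_le _ _ hr)).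
Qed.

Definition dvd (u y : M) : Prop := exists w, u * w = y.

Lemma dvd_mulr u x y : dvd u x -> dvd u (y * x).
Proof. intros [w <-]; exists (y * w); ring. Qed.

Lemma dvd_add_inv u x y : 0 < u -> dvd u (x + y) -> dvd u y -> dvd u x.
Proof.
intros hu [a ha] [b <-]; assert (hba : b <= a).
{ apply mul_le_cancel with u; [exact hu|].
  replace (a * u) with (u * a) by ring; rewrite ha; exists x; ring. }
destruct hba as [s <-]; exists s; apply add_cancel with (u * b).
rewrite <- ha; ring.
Qed.

Lemma common_multiple m x :
  exists y, 0 < y /\ forall z, z < x -> dvd (1 + z * m) y.
Proof.
(* Under the innermost quantifier, variables 0 to 4 are the cofactor, [z], [y], the bound [x] and
   the parameter [m]. *)
pose (p := FEx (FAnd (FLt TZero (TVar 0))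
  (FAll (FImp (FLt (TVar 0) (TVar 2))
    (FEx (FEq (TMul (TAdd TOne (TMul (TVar 1) (TVar 4))) (TVar 0))
              (TVar 2))))))).
apply (PA_induction _ hM p (fun _ => m)); simpl.
- exists 1; split; [apply (PA_lt01 _ hM)|intros z hz; now apply not_lt_0 in hz].
- intros x0 [y [hy hdvd]]; exists ((1 + x0 * m) * y); split.
  + apply mul_pos; [apply pos_add_r, (PA_lt01 _ hM)|exact hy].
  + intros z hz; destruct (lt_succ_inv _ _ hz) as [h| ->].
    * apply dvd_mulr, (hdvd _ h).
    * now exists y.
Qed.

(** Modulo [1 + z * m] the inverse of [m] is [- z]; without subtraction this reads
    [w + z * (m * w) = (1 + z * m) * w]. *)
Lemma dvd_coprime_factor m z w :
  dvd (1 + z * m) (m * w) -> dvd (1 + z * m) w.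
Proof.
intros h; apply dvd_add_inv with (z * (m * w)).
- apply pos_add_r, (PA_lt01 _ hM).
- exists w; ring.
- now apply dvd_mulr.
Qed.

(* The difference [delta * m] of the two moduli divides [m * m], which is
   invertible modulo [1 + z * m]. *)
Lemma dvd_coprime_progression m z delta w :
  dvd delta m -> dvd (1 + z * m) ((1 + (z + delta) * m) * w) ->
  dvd (1 + z * m) w.
Proof.
intros [e he] h; do 2 apply dvd_coprime_factor.
replace (m * (m * w)) with (e * (delta * m * w)) by (rewrite <- he; ring).
apply dvd_mulr, dvd_add_inv with ((1 + z * m) * w).
- apply pos_add_r, (PA_lt01 _ hM).
- replace (delta * m * w + (1 + z * m) * w)
    with ((1 + (z + delta) * m) * w) by ring; exact h.
- now exists w.
Qed.

(** * An element above all standard powers of a nonstandard one *)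

Fixpoint power (c : M) (n : nat) : M :=
  match n with
  | O => 1
  | S k => c * power c k
  end.

(** Induction on [n]: split off from [y] the modulus with the largest index. By coprimality the
    others still divide the cofactor [w]. Indices start at 1, so each modulus split off is at least
    [1 + m]. *)
Lemma power_le_common_multiple m n y :
  (forall i, dvd (numeral M (S i)) m) -> 0 < y ->
  (forall i, Peano.lt i n -> dvd (1 + numeral M (S i) * m) y) ->
  power (1 + m) n <= y.
Proof.
intros hm; revert y; induction n as [|n IH]; intros y hy hdvd.
- now apply one_le.
- destruct (hdvd n (PeanoNat.Nat.lt_succ_diag_r n)) as [w hw].
  assert (hpow : power (1 + m) n <= w).
  { apply IH.
    - rewrite <- hw in hy; exact (factor_pos _ _ hy).
    - intros i hi; apply dvd_coprime_progression with (numeral M (n - i)).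
      (* The two indices [S n] and [S i] differ by a positive numeral, hence by a divisor of [m]. *)
      + replace (n - i)%nat with (S (n - S i)); [apply hm|].
        rewrite <- PeanoNat.Nat.sub_succ_l; [reflexivity|exact hi].
      + rewrite <- numeral_add.
        replace (S i + (n - i))%nat with (S n).
        * rewrite hw; apply hdvd, PeanoNat.Nat.lt_lt_succ_r, hi.
        * simpl; f_equal; symmetry; rewrite PeanoNat.Nat.add_comm.
          apply PeanoNat.Nat.sub_add, PeanoNat.Nat.lt_le_incl, hi. }
  rewrite <- hw; apply le_mul; [|exact hpow].
  apply le_add; [apply le_refl|]; simpl; exists (numeral M n * m); ring.
Qed.

Lemma exists_power_gap (k : M) : ~ standard k ->
  exists m a, ~ standard m /\ forall n, power (1 + m) n <= a.
Proof.
intros hk.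
(* The moduli are here [1 + z] for [z < k], and [k] exceeds every numeral, so all positive numerals
   divide [m]. *)
destruct (common_multiple 1 k) as [m [hm0 hm]].
assert (hdvd : forall i, dvd (numeral M (S i)) m).
{ intros i; replace (numeral M (S i)) with (1 + numeral M i * 1)
    by (simpl; ring); apply hm, numeral_lt_nonstandard, hk. }
destruct (common_multiple m k) as [a [ha0 ha]].
exists m, a; split.
(* If [m] were the numeral [p], the larger numeral [p + 1] would divide the positive [m]. *)
- intros [p hp]; destruct (hdvd p) as [w hw].
  apply (lt_ge_false m (numeral M (S p))); [rewrite hp; apply lt_succ|].
  rewrite <- hw.
  replace (numeral M (S p)) with (numeral M (S p) * 1) at 1 by ring.
  apply le_mul; [apply le_refl|apply one_le].
  apply factor_pos with (numeral M (S p)); now rewrite hw.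
- intros n; apply power_le_common_multiple; [exact hdvd|exact ha0|].
  intros i _; apply ha, numeral_lt_nonstandard, hk.
Qed.

(** * Multiplication by [1 + d] modulo [J], lifted to an order automorphism *)

Section Rescaling.

Variables (d : M) (J : M -> Prop).
Hypothesis J_zero : J 0.
Hypothesis J_le : forall x y, x <= y -> J y -> J x.
Hypothesis J_add : forall x y, J x -> J y -> J (x + y).
Hypothesis J_mul : forall x, J x -> J ((1 + d) * x).
Hypothesis J_factor : J (1 + d).

Definition close (x y : M) : Prop :=
  exists j, J j /\ x <= y + j /\ y <= x + j.

Lemma close_refl x : close x x.
Proof. exists 0; repeat split; [exact J_zero|apply le_addr..]. Qed.

Lemma close_sym x y : close x y -> close y x.
Proof. intros [j [hj [h1 h2]]]; now exists j. Qed.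

Lemma close_trans x y z : close x y -> close y z -> close x z.
Proof.
intros [i [hi [h1 h2]]] [j [hj [h3 h4]]]; exists (i + j).
repeat split; [now apply J_add| |].
- apply le_trans with (y + i); [exact h1|].
  replace (z + (i + j)) with (z + j + i) by ring.
  apply le_add; [exact h3|apply le_refl].
- apply le_trans with (y + j); [exact h4|].
  replace (x + (i + j)) with (x + i + j) by ring.
  apply le_add; [exact h2|apply le_refl].
Qed.

(* Choosing [0] as the representative of [J] itself makes [rescale] the
   identity on [J]. *)
Definition representative (x : M) : M :=
  epsilon (inhabits 0) (fun z => close x z /\ (close x 0 -> z = 0)).

Lemma representative_spec x :
  close x (representative x) /\ (close x 0 -> representative x = 0).
Proof.
apply (epsilon_spec (inhabits 0) (fun z => close x z /\ (close x 0 -> z = 0))).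
destruct (classic (close x 0)) as [h|h].
- now exists 0.
- exists x; split; [apply close_refl|now intros].
Qed.

(** Close elements give [epsilon] extensionally equal predicates, hence the same choice. *)
Lemma representative_close x y :
  close x y -> representative x = representative y.
Proof.
intros h; unfold representative; f_equal.
apply functional_extensionality; intros z.
assert (hc : forall t, close x t <-> close y t)
  by (intros t; split; apply close_trans; [now apply close_sym|exact h]).
apply propositional_extensionality; now rewrite (hc z), (hc 0).
Qed.

(** Reversed representatives would squeeze [y] to within an element of [J] above [x]; then both lie
    in one class and share their representative. *)
Lemma representative_le x y : x <= y -> representative x <= representative y.
Proof.
intros hxy; destruct (lt_or_le (representative y) (representative x)) as [h|h];
  [|exact h].
rewrite (representative_close x y); [apply le_refl|].
destruct (representative_spec x) as [[i [hi [_ h1]]] _].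
destruct (representative_spec y) as [[j [hj [h2 _]]] _].
exists (i + j); repeat split; [now apply J_add| |].
- apply le_trans with y; [exact hxy|apply le_addr].
- apply le_trans with (representative y + j); [exact h2|].
  replace (x + (i + j)) with (x + i + j) by ring.
  apply le_add; [|apply le_refl].
  apply le_trans with (representative x); [now apply lt_le|exact h1].
Qed.

(* On the class of [r = representative x] this is the translation that moves
   [r] to [(1 + d) * r]. *)
Definition rescale (x : M) : M := x + d * representative x.

Lemma rescale_lt x y : x < y -> rescale x < rescale y.
Proof.
intros h; apply add_lt_le; [exact h|].
apply le_mul; [apply le_refl|apply representative_le; now apply lt_le].
Qed.

Lemma J_mul_d x : J x -> J (d * x).
Proof.
intros h; apply J_le with ((1 + d) * x); [exists x; ring|now apply J_mul].
Qed.

Lemma rescale_surj y : exists x, rescale x = y.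
Proof.
destruct (euclid_div (1 + d) y (pos_add_r _ _ (PA_lt01 _ hM))) as [q [s [hy hs]]].
destruct (representative_spec q) as [hq hq0].
pose (r := representative q); fold r in hq, hq0.
(* [q] is close to [r], multiplication by [1 + d] preserves [J], and the remainder [s < 1 + d] stays
   within [J]. *)
assert (hyr : close y (r + d * r)).
{ destruct hq as [j [hj [h1 h2]]]; exists ((1 + d) * j + (1 + d)).
  replace (r + d * r) with ((1 + d) * r) by ring; rewrite hy.
  repeat split; [now apply J_add, J_factor; apply J_mul| |].
  - replace ((1 + d) * r + ((1 + d) * j + (1 + d)))
      with ((1 + d) * (r + j) + (1 + d)) by ring.
    apply le_add; [apply le_mul; [apply le_refl|exact h1]|now apply lt_le].
  - apply le_trans with ((1 + d) * (q + j)).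
    + apply le_mul; [apply le_refl|exact h2].
    + exists (s + (1 + d)); ring. }
(* This makes the preimage [y - d * r] available. If [q] is in [J], then [r = 0]; otherwise the
   error [d * j] is in [J], so it is at most [q] and is absorbed by [y = d * q + q + s]. *)
assert (hle : d * r <= y).
{ destruct (classic (J q)) as [hJq|hJq].
  - rewrite hq0; [exists y; ring|exists q; repeat split; [exact hJq| |]].
    + exists 0; ring.
    + apply le_0_l.
  - destruct hq as [j [hj [_ h2]]].
    apply le_trans with (d * (q + j)); [apply le_mul; [apply le_refl|exact h2]|].
    destruct (lt_or_le q (d * j)) as [h|h].
    + destruct hJq; apply J_le with (d * j); [now apply lt_le|now apply J_mul_d].
    + apply le_trans with (d * q + q).
      * replace (d * (q + j)) with (d * q + d * j) by ring.
        apply le_add; [apply le_refl|exact h].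
      * rewrite hy; exists s; ring. }
destruct hle as [x hx]; exists x; unfold rescale.
(* Subtracting [d * r] from [hyr] shows that [x] is close to [r], so [x] lies in the class of
   [q]. *)
replace (representative x) with r; [rewrite <- hx; ring|].
apply representative_close, close_trans with r; [exact hq|].
apply close_sym; destruct hyr as [j [hj [h1 h2]]]; exists j.
repeat split; [exact hj| |]; apply add_le_cancel with (d * r).
- replace (x + d * r) with y by (rewrite <- hx; ring).
  replace (r + j + d * r) with (r + d * r + j) by ring; exact h1.
- replace (x + j + d * r) with (y + j) by (rewrite <- hx; ring); exact h2.
Qed.

Lemma rescale_order_iso : order_iso (@lt M) (@lt M) rescale.
Proof.
assert (hinj : forall x y, rescale x = rescale y -> x = y).
{ intros x y h; destruct (PA_lt_total _ hM x y) as [h'|[h'|h']]; [|exact h'|];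
    apply rescale_lt in h'; rewrite h in h'; now apply (PA_lt_irrefl _ hM) in h'. }
split.
- destruct (choice _ rescale_surj) as [g hg].
  exists g; [intros x; apply hinj, hg|exact hg].
- intros x y; split; [apply rescale_lt|].
  intros h; destruct (lt_or_le x y) as [h'|h']; [exact h'|].
  destruct (PA_lt_total _ hM y x) as [h1|[h1|h1]].
  + apply rescale_lt in h1.
    destruct (lt_ge_false _ _ h (lt_le _ _ h1)).
  + rewrite h1 in h; now apply (PA_lt_irrefl _ hM) in h.
  + exact h1.
Qed.

(** An error [j] in [J] with [a <= r + j] cannot exceed the representative [r], or [a <= j + j]
    would lie in [J]. *)
Lemma le_double_representative a :
  ~ J a -> a <= representative a + representative a.
Proof.
intros ha; destruct (representative_spec a) as [[j [hj [h1 _]]] _].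
apply le_trans with (representative a + j); [exact h1|].
apply le_add; [apply le_refl|].
destruct (lt_or_le (representative a) j) as [h|h]; [|exact h].
destruct ha; apply J_le with (j + j); [|now apply J_add].
apply le_trans with (representative a + j); [exact h1|].
apply le_add; [now apply lt_le|apply le_refl].
Qed.

(** With [r] the representative, [rescale a] is at least [d * r] while [a] is at most [r + r]; a
    ratio below [n] forces [d < 2n]. *)
Lemma rescale_not_E2 a : ~ standard d -> ~ J a -> ~ E2 a (rescale a).
Proof.
intros hd ha [n [_ h]]; apply hd.
apply lt_numeral_standard with (n + n)%nat.
pose (r := representative a).
destruct (lt_or_le d (numeral M (n + n))) as [h'|h']; [exact h'|exfalso].
apply (lt_ge_false _ _ h).
apply le_trans with ((r + r) * numeral M n).
- apply le_mul; [now apply le_double_representative|apply le_refl].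
- replace ((r + r) * numeral M n) with (numeral M (n + n) * r)
    by (rewrite numeral_add; ring).
  apply le_trans with (d * r); [apply le_mul; [exact h'|apply le_refl]|].
  unfold rescale; exists a; fold r; ring.
Qed.

End Rescaling.

(** * Rigidity forces standardness *)

Lemma below_order_isomorphic (f : M -> M) a :
  order_iso (@lt M) (@lt M) f ->
  order_isomorphic (below_lt a) (below_lt (f a)).
Proof.
intros [[g fK gK] hf].
assert (hg : forall y, y < f a -> g y < a)
  by (intros y hy; apply hf; now rewrite gK).
exists (fun x : below a =>
  exist (fun y => y < f a) (f (proj1_sig x))
    (proj1 (hf _ _) (proj2_sig x))); split.
- exists (fun y : below (f a) =>
    exist (fun x => x < a) (g (proj1_sig y)) (hg _ (proj2_sig y))).
  + intros [x hx]; apply subset_eq_compat, fK.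
  + intros [y hy]; apply subset_eq_compat, gK.
- intros x y; apply hf.
Qed.

Lemma power_add_le c i j : 1 <= c -> power c i <= power c (i + j).
Proof.
intros hc; rewrite PeanoNat.Nat.add_comm; induction j as [|j IH]; simpl;
  [apply le_refl|].
apply le_trans with (power c (j + i)); [exact IH|].
replace (power c (j + i)) with (1 * power c (j + i)) at 1 by ring.
apply le_mul; [exact hc|apply le_refl].
Qed.

Lemma two_order_rigid_standard : two_order_rigid M -> forall x : M, standard x.
Proof.
intros hrigid x; apply NNPP; intros hx.
destruct (exists_power_gap x hx) as [d [a [hd ha]]].
pose (c := 1 + d); pose (J := fun x => exists n, x < power c n).
assert (hc : 1 <= c) by apply le_addr.
assert (hc2 : 1 + 1 <= c)
  by (apply le_add; [apply le_refl|apply one_le, (numeral_lt_nonstandard d 0 hd)]).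
assert (hc0 : 0 < c) by apply pos_add_r, (PA_lt01 _ hM).
assert (J_zero : J 0) by (exists O; apply (PA_lt01 _ hM)).
assert (J_le : forall x y, x <= y -> J y -> J x)
  by (intros u v huv [n hn]; exists n; exact (le_lt_trans _ _ _ huv hn)).
assert (J_add : forall x y, J x -> J y -> J (x + y)).
(* The extra factor [c >= 2] absorbs the sum of two terms, each at most [power c (i + j)]. *)
{ intros u v [i hi] [j hj]; exists (S (i + j)).
  apply lt_le_trans with (power c i + power c j).
  - apply add_lt_le; [exact hi|now apply lt_le].
  - apply le_trans with (power c (i + j) + power c (i + j)).
    + apply le_add; [now apply power_add_le|].
      rewrite PeanoNat.Nat.add_comm; now apply power_add_le.
    + replace (power c (i + j) + power c (i + j))
        with ((1 + 1) * power c (i + j)) by ring.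
      apply le_mul; [exact hc2|apply le_refl]. }
assert (J_mul : forall x, J x -> J (c * x)).
{ intros u [n hn]; exists (S n); simpl.
  rewrite (PA_mulC _ hM c u), (PA_mulC _ hM c (power c n)).
  now apply (PA_lt_mul _ hM). }
assert (J_c : J c).
{ replace c with (c * 1) by ring; apply J_mul.
  exists 1%nat; simpl; replace (c * 1) with c by ring.
  apply succ_le_lt, hc2. }
assert (hJa : ~ J a) by (intros [n hn]; exact (lt_ge_false _ _ hn (ha n))).
assert (ha_std : ~ standard a).
(* The bound on the first power gives [d <= a], so a standard [a] would make [d] standard. *)
{ intros [n hn]; apply hd, lt_numeral_standard with (S n); simpl; rewrite <- hn.
  apply le_lt_trans with a; [|apply lt_succ].
  apply le_trans with (2 := ha 1%nat); exists 1; simpl; ring. }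
apply (rescale_not_E2 d J J_zero J_le J_add a hd hJa).
apply hrigid; [exact ha_std| |].
- intros [n hn]; apply ha_std, lt_numeral_standard with (S n); simpl.
  rewrite <- hn; apply le_lt_trans with (rescale d J a);
    [apply le_addr|apply lt_succ].
- now apply below_order_isomorphic, rescale_order_iso.
Qed.

End Arithmetic.

(** * Order isomorphisms on numerals, and the conclusion *)

(** Zero is the least element and [x + 1] the immediate successor of [x]; both notions are preserved
    by order isomorphisms. *)
Lemma order_iso_numeral (M N : structure) (hM : models_PA M) (hN : models_PA N)
    (f : M -> N) (n : nat) :
  order_iso (@lt M) (@lt N) f -> f (numeral M n) = numeral N n.
Proof.
intros [[g fK gK] hf]; induction n as [|n IH]; simpl.
- destruct (PA_nonneg _ hN (f zero)) as [h|h]; [exact h|exfalso].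
  rewrite <- (gK zero) in h; apply hf in h; exact (not_lt_0 M hM _ h).
- apply (le_antisym N hN).
  + destruct (lt_or_le N hN (add (numeral N n) one) (f (add (numeral M n) one)))
      as [h|h]; [exfalso|exact h].
    rewrite <- (gK (add (numeral N n) one)) in h; apply hf in h.
    apply (lt_ge_false M hM _ _ h), (lt_succ_le M hM), hf.
    rewrite gK, IH; apply (lt_succ N hN).
  + rewrite <- IH; apply (lt_succ_le N hN), hf, (lt_succ M hM).
Qed.

Theorem theorem1p7 (M1 M2 : structure)
    (hM1 : models_PA M1) (hM2 : models_PA M2)
    (hrigid : two_order_rigid M1)
    (hiso : order_isomorphic (@lt M1) (@lt M2)) :
  almost_lt_add_isomorphic M1 M2.
Proof.
destruct hiso as [f hf]; exists f; split; [exact hf|].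
(* The distance is 0: all elements of [M1] are numerals, on which [f] is exactly additive. *)
intros a b; exists O; left; simpl; rewrite (PA_add0 _ hM2).
destruct (two_order_rigid_standard M1 hM1 hrigid a) as [i ->].
destruct (two_order_rigid_standard M1 hM1 hrigid b) as [j ->].
rewrite <- (numeral_add M1 hM1), !(order_iso_numeral M1 M2 hM1 hM2 f _ hf).
apply (numeral_add M2 hM2).
Qed.
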